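(* Let $f_1,\dots,f_M:\mathbb{R}^d\to\mathbb{R}$ be differentiable local objective functions, let $f(x):=\frac1M\sum_{i=1}^M f_i(x)$, and let $x^*:=\arg\min_x f(x)$. For each $i\in[M]$ let $g_i(x,\xi)$ be a stochastic gradient of $f_i$. Suppose that: (i) the global function $f$ is $L$-smooth: $\|\nabla f(x)-\nabla f(y)\|_2\le L\|x-y\|_2$ for all $x,y\in\mathbb{R}^d$; (ii) the global function $f$ is $\mu$-strongly convex ($\mu>0$): $f(y)\ge f(x)+\langle\nabla f(x),y-x\rangle+\frac{\mu}{2}\|x-y\|_2^2$ for all $x,y\in\mathbb{R}^d$; (iii) for each $i\in[M]$, $\mathbb{E}_\xi[g_i(x,\xi)]=\nabla f_i(x)$ for all $x\in\mathbb{R}^d$; (iv) for some constant $\sigma^2>0$ and each $i\in[M]$, $\mathbb{E}_\xi\left[\exp\left(\|g_i(x,\xi)-\nabla f_i(x)\|_2^2/\sigma^2\right)\right]\le\exp(1)$ for all $x\in\mathbb{R}^d$; (v) the stochastic processes $\{\xi_{i,t}\}_t$ and $\{\xi_{j,t}\}_t$ of agents' samples are statistically independent for all $i\neq j\in[M]$. Let $\kappa:=L/\mu$. Then, given any $\delta\in(0,1)$, there exists a universal constant $c$ such that, for Batched FL run with $T=KH$ samples per agent, $K=4\kappa\log(MT)$ communication rounds and step-size $\alpha=1/(2L)$, and with $r^{(k)}:=f(\bar x^{(k)})-f(x^* )$, the following holds with probability at least $1-\delta$: $$r^{(K)}\le\frac{r^{(0)}}{MT}+\frac{16c^2\kappa\sigma^2}{\mu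 MT}\log(MT)\,\log\frac{2dT}{\delta}.$$
   Context: $[M]:=\{1,\dots,M\}$. Batched FL: agent $i\in[M]$ has $T$ online samples $\xi_{i,0},\dots,\xi_{i,T-1}$, which for each agent are i.i.d. over time, split into $K$ communication rounds of $H$ samples each, with $T=KH$ and $K,H$ positive integers (the prescribed value of $K$ is assumed to be a positive integer dividing $T$). Expectations $\mathbb{E}_\xi$ in the assumptions on $g_i$ are with respect to the distribution of agent $i$'s samples. Starting from a deterministic initial global parameter $\bar x^{(0)}\in\mathbb{R}^d$, in each round $k=0,\dots,K-1$, every agent $i$ computes $$g_{i,k}:=\frac1H\sum_{\ell=0}^{H-1}g_i(\bar x^{(k)},\xi_{i,kH+\ell}),\qquad x_i^{(k)}=\bar x^{(k)}-\alpha g_{i,k},$$ and the server sets $$\bar x^{(k+1)}=\frac1M\sum_{i\in[M]}x_i^{(k)} .$$ $\log$ is the natural logarithm. ''Universal constant'' means an absolute constant, independent of the $f_i$, $g_i$, $d$, $L$, $\mu$, $\sigma$, $M$, $T$, $K$, $H$, $\delta$, $\bar x^{(0)}$.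
   Formalization: In (v), the agents' sample processes are assumed jointly (mutually) independent; with independence only for each pair i≠j the bound fails (for example, noise given by Walsh characters). *)

(* Defs.v *)
From HB Require Import structures.
From mathcomp Require Import all_boot all_order all_algebra.
From mathcomp Require Import all_classical all_reals all_analysis.

Set Implicit Arguments.
Unset Strict Implicit.
Unset Printing Implicit Defensive.

Import Order.TTheory GRing.Theory Num.Theory.
Import numFieldNormedType.Exports.

Local Open Scope classical_set_scope.
Local Open Scope ring_scope.

(* The library norm [`|x|] on ['rV[R]_d] is the sup norm; it is used only for
   the topology and differentiability, which do not depend on the norm. *)
Definition dotp (R : realType) (d : nat) (u v : 'rV[R]_d) : R :=
  \sum_j u 0 j * v 0 j.

Definition l2norm (R : realType) (d : nat) (u : 'rV[R]_d) : R :=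
  Num.sqrt (dotp u u).

Definition grad (R : realType) (d : nat) (f : 'rV[R]_d -> R) (x : 'rV[R]_d) :
    'rV[R]_d :=
  \row_j 'D_(delta_mx 0 j) f x.

Definition smooth (R : realType) (d : nat) (L : R) (f : 'rV[R]_d -> R) : Prop :=
  forall x y, l2norm (grad f x - grad f y) <= L * l2norm (x - y).

Definition strongly_convex (R : realType) (d : nat) (mu : R)
    (f : 'rV[R]_d -> R) : Prop :=
  forall x y,
    f x + dotp (grad f x) (y - x) + mu / 2 * l2norm (x - y) ^+ 2 <= f y.

Definition global_objective (R : realType) (d M : nat)
    (f : 'I_M -> 'rV[R]_d -> R) (x : 'rV[R]_d) : R :=
  M%:R^-1 * \sum_i f i x.

Definition borel_rV (R : realType) (d : nat) :=
  g_sigma_algebraType (@open 'rV[R]_d).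

(* Measurability jointly in the point and the sample: for each fixed point alone
   it would not make the iterates, which are random points, measurable. *)
Definition measurable_oracle (R : realType) (d : nat) (dX : measure_display)
    (X : measurableType dX) (g : 'rV[R]_d -> X -> 'rV[R]_d) : Prop :=
  measurable_fun [set: borel_rV R d * X]
    (fun p => g p.1 p.2 : borel_rV R d).

Definition unbiased_oracle (R : realType) (d : nat) (dX : measure_display)
    (X : measurableType dX) (D : probability X R) (f : 'rV[R]_d -> R)
    (g : 'rV[R]_d -> X -> 'rV[R]_d) : Prop :=
  forall x j, ('E_D[fun s => g x s 0%R j] = (grad f x 0%R j)%:E)%E.

Definition light_tailed_oracle (R : realType) (d : nat) (dX : measure_display)
    (X : measurableType dX) (D : probability X R) (f : 'rV[R]_d -> R)
    (g : 'rV[R]_d -> X -> 'rV[R]_d) (sigma : R) : Prop :=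
  forall x,
    ('E_D[fun s => expR (l2norm (g x s - grad f x) ^+ 2 / sigma ^+ 2)%R]
       <= (expR 1)%:E)%E.

(* Joint independence of all the members of the family, which is stronger than
   independence of each pair. *)
Definition mutually_independent (R : realType) (dO : measure_display)
    (Omega : measurableType dO) (P : probability Omega R) (I : finType)
    (F : I -> set (set Omega)) : Prop :=
  forall (J : {set I}) (A : I -> set Omega),
    (forall i, i \in J -> F i (A i)) ->
    (P (\bigcap_(i in [set` J]) A i) = \prod_(i in J) P (A i))%E.

(* Processes are indexed by [nat] to avoid ordinal arithmetic in the algorithm;
   only the samples [t < T] are constrained or used. *)
Definition process_sigma_algebra (dO dX : measure_display)
    (Omega : measurableType dO) (X : measurableType dX) (T : nat)
    (xi : nat -> Omega -> X) : set (set Omega) :=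
  <<s \bigcup_(t in `I_T) g_sigma_algebra_preimage (xi t) >>.

Definition iid (R : realType) (dO dX : measure_display)
    (Omega : measurableType dO) (P : probability Omega R)
    (X : measurableType dX) (T : nat) (D : probability X R)
    (xi : nat -> Omega -> X) : Prop :=
  (forall t, (t < T)%N -> forall B, measurable B -> P (xi t @^-1` B) = D B) /\
  mutually_independent P (fun t : 'I_T => g_sigma_algebra_preimage (xi t)).

(* [xi i t] is here a realized value of the [t]-th sample of agent [i]. *)
Section BatchedFL.
Variables (R : realType) (d M H : nat) (X : 'I_M -> Type).
Variables (g : forall i, 'rV[R]_d -> X i -> 'rV[R]_d).
Variables (alpha : R) (x0 : 'rV[R]_d).

Definition batch_gradient (xi : forall i, nat -> X i) (k : nat)
    (x : 'rV[R]_d) (i : 'I_M) : 'rV[R]_d :=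
  H%:R^-1 *: \sum_(l < H) g x (xi i (k * H + l)%N).

Definition local_step (xi : forall i, nat -> X i) (k : nat)
    (x : 'rV[R]_d) (i : 'I_M) : 'rV[R]_d :=
  x - alpha *: batch_gradient xi k x i.

Fixpoint batched_FL (xi : forall i, nat -> X i) (k : nat) : 'rV[R]_d :=
  if k is k'.+1 then
    M%:R^-1 *: \sum_i local_step xi k' (batched_FL xi k') i
  else x0.

End BatchedFL.

(* Main.v *)
Require Import Defs.
From HB Require Import structures.
From mathcomp Require Import all_boot all_order all_algebra.
From mathcomp Require Import all_classical all_reals all_analysis.
From mathcomp Require Import measurable_realfun.
From mathcomp Require Import ring lra.
Import Order.TTheory GRing.Theory Num.Theory.
Import numFieldNormedType.Exports.
Local Open Scope classical_set_scope.
Local Open Scope ring_scope.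

Set Implicit Arguments.
Unset Strict Implicit.
Unset Printing Implicit Defensive.

(** Write [e k] for the average of the noise [g_i (x, xi) - grad f_i x] over the
[n = M H] samples of round [k], where [x] is the iterate at the start of the
round.  One round is one gradient step on the global objective [F] with
gradient [grad F x + e k].

On the deterministic side, strong convexity and smoothness alone give, with the
step size [1 / (2 L)], the recursion
[r (k+1) <= (1 - mu / (2 L)) r k + |e k|^2 / (4 L)] ([gradient_step]).  After
[K = 4 kappa ln (M T)] rounds the contraction factor is at most
[(M T)^-2], and the geometric series of the perturbations is at most
[max_k |e k|^2 / (2 mu)].  It remains to show that, with probability at least
[1 - delta], every [|e k|^2] is at most [64 sigma^2 ln (2 d T / delta) / n].

On the stochastic side, this is a dimension-free tail bound for sums of
[n] centered vectors with light-tailed norms.  It follows from the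
exponential moment of the squared norm: for a noise vector [Z] that is
conditionally centered given [v],
[E exp (th |v + Z|^2) <= exp ((th + 32 th^2 sigma^2) |v|^2 + 2 th sigma^2)]
([exp_sqr_norm_step]).  So adding one sample only moves [th] slightly, and
adding all the samples of a round, starting from [th = 1 / (64 n sigma^2)],
leaves a bounded total ([integral_exp_partial_noise]).  Working with the
squared norm directly, rather than with coordinates, is what keeps [d] out of
the variance.  Markov's inequality and a union bound over the [K <= T] rounds
conclude.

The conditional centering is where independence enters.  Each sample is
independent of the sigma-algebra generated by all the other samples
([independent_of_the_rest]), and both the iterate and the sum of the
noise of other samples are measurable for that sigma-algebra.  The joint law of
this past and of the sample is therefore a product measure, and Tonelli's
theorem integrates the sample first, the iterate being held fixed
([integral_freeze]). *)

(** * Euclidean geometry and perturbed gradient descent *)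

Section Euclidean.
Variables (R : realType) (d : nat).
Implicit Types u v w : 'rV[R]_d.

Lemma dotpC u v : dotp u v = dotp v u.
Proof. by apply: eq_bigr => j _; rewrite mulrC. Qed.

Lemma dotpDl u v w : dotp (u + v) w = dotp u w + dotp v w.
Proof.
by rewrite -big_split; apply: eq_bigr => j _; rewrite /= mxE mulrDl.
Qed.

Lemma dotpZl (a : R) u v : dotp (a *: u) v = a * dotp u v.
Proof. by rewrite mulr_sumr; apply: eq_bigr => j _; rewrite mxE mulrA. Qed.

Lemma dotpDr u v w : dotp u (v + w) = dotp u v + dotp u w.
Proof. by rewrite dotpC dotpDl !(dotpC u). Qed.

Lemma dotpZr (a : R) u v : dotp u (a *: v) = a * dotp u v.
Proof. by rewrite dotpC dotpZl dotpC. Qed.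

Lemma dotpNl u v : dotp (- u) v = - dotp u v.
Proof. by rewrite -scaleN1r dotpZl mulN1r. Qed.

Lemma dotpNr u v : dotp u (- v) = - dotp u v.
Proof. by rewrite dotpC dotpNl dotpC. Qed.

Lemma dotp_ge0 u : 0 <= dotp u u.
Proof. by apply: sumr_ge0 => j _; rewrite -expr2 sqr_ge0. Qed.

Lemma dotp0l v : dotp 0 v = 0.
Proof. by apply: big1 => j _; rewrite mxE mul0r. Qed.

Lemma dotp_eq0 u : dotp u u = 0 -> u = 0.
Proof.
move=> /eqP; rewrite psumr_eq0 => [/allP h|j _]; last by rewrite -expr2 sqr_ge0.
apply/rowP => j; rewrite mxE; apply/eqP.
by have := h j (mem_index_enum j); rewrite /= -expr2 sqrf_eq0.
Qed.

Lemma l2norm_sqr u : l2norm u ^+ 2 = dotp u u.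
Proof. by rewrite sqr_sqrtr// dotp_ge0. Qed.

Definition dotpE := (dotpDl, dotpDr, dotpNl, dotpNr, dotpZl, dotpZr).

Lemma dotp_young (a : R) u v : 0 < a ->
  - (dotp u u / (2 * a) + a / 2 * dotp v v) <= dotp u v.
Proof.
move=> a0; have := dotp_ge0 (u + a *: v); rewrite !dotpE (dotpC v u) => h.
rewrite -subr_ge0.
have -> : dotp u v - - (dotp u u / (2 * a) + a / 2 * dotp v v) =
  (2 * a)^-1 * (dotp u u + a * dotp u v + a * (dotp u v + a * dotp v v)).
  by field; lra.
by apply: mulr_ge0; [rewrite invr_ge0; lra | lra].
Qed.

(** Expand the squared norm of [|v|^2 u - (u.v) v]. *)
Lemma cauchy_schwarz u v : dotp u v ^+ 2 <= dotp u u * dotp v v.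
Proof.
have [v0|v0] := eqVneq (dotp v v) 0.
  by rewrite (dotp_eq0 v0) dotpC dotp0l expr0n mulr_ge0// dotp_ge0.
have vp : 0 < dotp v v by rewrite lt_def v0 dotp_ge0.
have := dotp_ge0 (dotp v v *: u - dotp u v *: v).
rewrite !dotpE (dotpC v u) => h.
rewrite -subr_ge0 -(pmulr_rge0 _ vp).
by apply: le_trans h _; lra.
Qed.

Lemma dotp_le_l2norm u v : dotp u v <= l2norm u * l2norm v.
Proof.
have n0 : 0 <= l2norm u * l2norm v by rewrite mulr_ge0 ?sqrtr_ge0.
have [uv0|/ltW uv0] := leP (dotp u v) 0; first exact: le_trans n0.
rewrite -(ler_pXn2r (ltn0Sn 1)) ?nnegrE// exprMn !l2norm_sqr.
exact: cauchy_schwarz.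
Qed.

End Euclidean.

Section Descent.
Variables (R : realType) (d : nat) (F : 'rV[R]_d -> R) (L mu : R).
Hypotheses (mu_gt0 : 0 < mu) (scF : strongly_convex mu F) (smF : smooth L F).
Implicit Types x y e : 'rV[R]_d.

(** The tangent inequality at [y] bounds [F y] from above, and smoothness then
moves the gradient from [y] to [x].  The constant [L] is twice the one obtained
by integrating the gradient along the segment; the step size [1 / (2 L)] absorbs
the difference. *)
Lemma descent x y :
  F y <= F x + dotp (grad F x) (y - x) + L * dotp (y - x) (y - x).
Proof.
have := scF y x; rewrite l2norm_sqr => hc.
have h2 : dotp (grad F y - grad F x) (y - x) <= L * dotp (y - x) (y - x).
  apply: le_trans (dotp_le_l2norm _ _) _.
  by rewrite -l2norm_sqr expr2 mulrA ler_wpM2r ?sqrtr_ge0//; exact: smF.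
have := dotp_ge0 (y - x).
have E : dotp (grad F y) (x - y) = - dotp (grad F y - grad F x) (y - x)
   - dotp (grad F x) (y - x).
  by rewrite -(opprB y x) dotpNr dotpDl dotpNl; ring.
rewrite E in hc => h3.
have : 0 <= mu / 2 * dotp (y - x) (y - x) by rewrite mulr_ge0// divr_ge0// ltW.
lra.
Qed.

(** The gradient is both [mu]-strongly monotone and [L]-Lipschitz. *)
Lemma strong_convexity_le_smoothness : (0 < d)%N -> mu <= L.
Proof.
move=> d0; pose y : 'rV[R]_d := const_mx 1; pose x : 'rV[R]_d := 0.
have yp : 0 < dotp (y - x) (y - x).
  rewrite subr0 /dotp; under eq_bigr do rewrite !mxE mulr1.
  by rewrite sumr_const card_ord ltr0n.
have hxy := scF x y; have hyx := scF y x.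
rewrite l2norm_sqr -(opprB y x) !(dotpNl, dotpNr) opprK in hxy.
rewrite l2norm_sqr -(opprB y x) !(dotpNl, dotpNr) in hyx.
have hs : dotp (grad F y - grad F x) (y - x) <= L * dotp (y - x) (y - x).
  apply: le_trans (dotp_le_l2norm _ _) _.
  by rewrite -l2norm_sqr expr2 mulrA ler_wpM2r ?sqrtr_ge0//; exact: smF.
rewrite dotpDl dotpNl in hs.
by rewrite -(ler_pM2r yp); lra.
Qed.

(** Minimizing the strong convexity lower bound over [xs]. *)
Lemma polyak_lojasiewicz x xs : 
  F x - F xs <= dotp (grad F x) (grad F x) / (2 * mu).
Proof.
have := scF x xs; have := dotp_young (grad F x) (xs - x) mu_gt0.
rewrite -(opprB xs x) l2norm_sqr !(dotpNl, dotpNr); lra.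
Qed.

(** With the step size [1 / (2 L)] the inner products of the gradient with the
perturbation [e] cancel exactly, so that [e] only enters through its square. *)
Lemma gradient_step x e xs : 0 < L ->
  F (x - (1 / (2 * L)) *: (grad F x + e)) - F xs <=
  (1 - mu / (2 * L)) * (F x - F xs) + dotp e e / (4 * L).
Proof.
move=> L0; have mu0 := mu_gt0.
have := descent x (x - (1 / (2 * L)) *: (grad F x + e)).
have := polyak_lojasiewicz x xs.
rewrite (addrC x) addrK !dotpE (dotpC e).
set n := dotp _ (grad F x); set m := dotp _ e; set q := dotp e e => h1 h2.
have E1 : L * - - (1 / (2 * L) * (1 / (2 * L) * (n + m + (m + q))))
   = (n + m + (m + q)) / (4 * L) by field; lra.
have E2 : - (1 / (2 * L) * (n + m)) = - (2 * (n + m) / (4 * L)) by field; lra.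
have h3 : mu / (2 * L) * (F x - F xs) <= n / (4 * L).
  have -> : n / (4 * L) = mu / (2 * L) * (n / (2 * mu)) by field; lra.
  by rewrite ler_wpM2l// divr_ge0//; lra.
lra.
Qed.

End Descent.

(** The fixed point of the recursion is [b / a], the sum of the geometric series
of the perturbations. *)
Lemma contraction_unroll (R : realType) (a b : R) (r : nat -> R) (K : nat) :
  0 < a <= 1 -> 0 <= b ->
  (forall k, (k < K)%N -> r k.+1 <= (1 - a) * r k + b) ->
  r K <= (1 - a) ^+ K * r 0%N + b / a.
Proof.
move=> /andP[a0 a1] b0; elim: K => [_|K IH h].
  by rewrite expr0 mul1r lerDl divr_ge0// ltW.
apply: le_trans (h K (ltnSn K)) _.
have a1' : 0 <= 1 - a by lra.
have := ler_wpM2l a1' (IH (fun k kK => h k (ltnW kK))).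
have : b = a * (b / a) by field; lra.
by rewrite exprS; set q := b / a; lra.
Qed.

Section ScalarMGF.
Variable R : realType.
Implicit Types y u : R.

(** For [y <= 1 / 2] one has [exp y <= 1 / (1 - y) <= 1 + y + 2 y^2], and for
larger [y] already [y <= 2 y^2]. *)
Lemma expR_le_addr_expR_sqr y : expR y <= y + expR (2 * y ^+ 2).
Proof.
have [yh|yh] := leP y (1/2).
  have h1 : 1 + 2 * y ^+ 2 <= expR (2 * y ^+ 2) by exact: expR_ge1Dx.
  have h2 := expR_ge1Dx (- y); have h3 : expR (- y) * expR y = 1.
    by rewrite -expRD addNr expR0.
  have p := expR_gt0 y.
  suff hs : expR y <= 1 + y + 2 * y ^+ 2 by lra.
  have h4 : (1 - y) * expR y <= 1 by rewrite -[leRHS]h3 ler_pM2r.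
  have h5 : (1 - y) * (1 + y + 2 * y ^+ 2) >= 1.
    have : 0 <= y ^+ 2 * (1 - 2 * y) by apply: mulr_ge0; [exact: sqr_ge0|lra].
    lra.
  suff h6 : (1 - y) * expR y <= (1 - y) * (1 + y + 2 * y ^+ 2).
    by move: h6; rewrite ler_pM2l//; lra.
  by apply: le_trans h4 h5.
have : expR y <= expR (2 * y ^+ 2).
  rewrite ler_expR; have : 0 <= y * (2 * y - 1) by apply: mulr_ge0; lra.
  lra.
lra.
Qed.

(** The chord of the convex map [p |-> exp (p w)] between 0 and 1; it follows
from the tangent inequality at [p w], used at [0] and at [w]. *)
Lemma expR_convex_combination (p w : R) : 0 <= p <= 1 ->
  expR (p * w) <= p * expR w + (1 - p).
Proof.
move=> /andP[p0 p1].
have H := expR_ge1Dx (w - p * w); have H2 := expR_ge1Dx (- (p * w)).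
have E1 : expR w = expR (w - p * w) * expR (p * w) by rewrite -expRD subrK.
have E2 : 1 = expR (- (p * w)) * expR (p * w) by rewrite -expRD addNr expR0.
have q := expR_gt0 (p * w).
have h1 : p * ((1 + (w - p * w)) * expR (p * w)) <= p * expR w.
  by rewrite ler_wpM2l// E1 ler_pM2r.
have h2 : (1 - p) * ((1 - p * w) * expR (p * w)) <= 1 - p.
  rewrite -[leRHS]mulr1; apply: ler_wpM2l; first lra.
  by rewrite [leRHS]E2 ler_pM2r.
have : p * ((1 + (w - p * w)) * expR (p * w)) +
  (1 - p) * ((1 - p * w) * expR (p * w)) = expR (p * w) by ring.
lra.
Qed.

End ScalarMGF.

(** * Exponential moments: adding one light-tailed vector *)

Section OneStep.
Variables (R : realType) (d : nat).
Implicit Types v z : 'rV[R]_d.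

(** The pointwise form of a subgaussian bound, to be integrated with [y] linear
in the noise and [w] its normalized squared norm.  For small [a] the inequality
[exp y <= y + exp (2 y^2)] keeps a linear term, which will integrate to 0.  For
large [a] the inequality [y <= (a + w) / 2] is sharp enough and [y] need not be
centered.  Both branches cost [exp (2 a)] once [exp (w - 1)] has mean at most 1. *)
Lemma linear_exponential_bound (a y w : R) : 0 <= a -> 0 <= w ->
  y ^+ 2 <= a * w ->
  expR y <= (if 2 * a <= 1
             then y + expR (2 * a) * (2 * a * expR (w - 1) + (1 - 2 * a))
             else expR (2 * a) * (1 / 2 * expR (w - 1) + 1 / 2)).
Proof.
move=> a0 w0 yw; case: ifPn => [ha|]; last rewrite -ltNge => ha.
  apply: le_trans (expR_le_addr_expR_sqr y) _; rewrite lerD2l.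
  apply: (@le_trans _ _ (expR (2 * a + 2 * a * (w - 1)))).
    by rewrite ler_expR; lra.
  rewrite [leLHS]expRD ler_wpM2l ?expR_ge0//.
  by apply: expR_convex_combination; lra.
apply: (@le_trans _ _ (expR (2 * a + 1 / 2 * (w - 1)))).
  rewrite ler_expR.
  have : y <= (a + w) / 2.
    apply: (@le_trans _ _ `|y|); first exact: ler_norm.
    rewrite -(ler_pXn2r (ltn0Sn 1)) ?nnegrE ?normr_ge0//; last lra.
    rewrite -normrX ger0_norm ?sqr_ge0//; apply: le_trans yw _.
    have := sqr_ge0 (a - w); lra.
  lra.
rewrite [leLHS]expRD ler_wpM2l ?expR_ge0//.
have h01 : 0 <= (1 / 2 : R) <= 1 by lra.
by apply: le_trans (expR_convex_combination _ h01) _; lra.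
Qed.

(** The exponential of the squared norm of [v + z] is dominated by a function
that is affine in [z] and in [exp (|z|^2 / s)]: integrating it only uses that
[z] is centered and light-tailed. *)
Lemma exp_sqr_norm_bound v (th s : R) :
  0 <= th -> 0 < s -> 2 * (th * s) <= 1 ->
  exists b A B : R, [/\ 0 <= A,
    A + B <= expR ((th + 32 * th ^+ 2 * s) * dotp v v + 2 * (th * s)) &
    forall z, expR (th * dotp (v + z) (v + z)) <=
      b * dotp v z + A * expR (dotp z z / s - 1) + B].
Proof.
move=> th0 s0 ths.
pose c0 := expR (th * dotp v v); pose u := th * s.
pose a := 16 * th ^+ 2 * s * dotp v v.
have c00 : 0 < c0 by exact: expR_gt0.
have u0 : 0 <= u by rewrite mulr_ge0// ltW.
have a0 : 0 <= a.
  by rewrite mulr_ge0 ?dotp_ge0// mulr_ge0 ?(ltW s0)// mulr_ge0 ?sqr_ge0//.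
(* Splitting the linear and the quadratic parts by [2 p q <= p^2 + q^2] doubles
   both exponents but loses no constant factor. *)
have step1 z : expR (th * dotp (v + z) (v + z)) <=
    c0 / 2 * (expR (4 * th * dotp v z) + expR (2 * u * (dotp z z / s))).
  have -> : expR (th * dotp (v + z) (v + z)) =
      c0 * (expR (2 * th * dotp v z) * expR (th * dotp z z)).
    by rewrite /c0 -!expRD !dotpE (dotpC z v); congr expR; ring.
  have -> : 4 * th * dotp v z = 2 * th * dotp v z + 2 * th * dotp v z by ring.
  have -> : 2 * u * (dotp z z / s) = th * dotp z z + th * dotp z z.
    by rewrite /u; field; lra.
  rewrite !expRD -[leRHS]mulrA ler_pM2l//.
  set p := expR _; set q := expR _; have := sqr_ge0 (p - q); lra.
have step2 z : expR (2 * u * (dotp z z / s)) <=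
    expR (2 * u) * (2 * u * expR (dotp z z / s - 1) + (1 - 2 * u)).
  have -> : 2 * u * (dotp z z / s) = 2 * u + 2 * u * (dotp z z / s - 1) by ring.
  rewrite [leLHS]expRD ler_wpM2l ?expR_ge0//.
  apply: expR_convex_combination; rewrite /u; apply/andP; split; last lra.
  by rewrite mulr_ge0.
have step3 z : (4 * th * dotp v z) ^+ 2 <= a * (dotp z z / s).
  have -> : a * (dotp z z / s) = 16 * th ^+ 2 * (dotp v v * dotp z z).
    by rewrite /a; field; lra.
  have -> : (4 * th * dotp v z) ^+ 2 = 16 * th ^+ 2 * dotp v z ^+ 2 by ring.
  by rewrite ler_wpM2l ?cauchy_schwarz// mulr_ge0 ?sqr_ge0.
have w0 z : 0 <= dotp z z / s by rewrite divr_ge0 ?dotp_ge0// ltW.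
have total : c0 / 2 * (expR (2 * a) + expR (2 * u)) <=
    expR ((th + 32 * th ^+ 2 * s) * dotp v v + 2 * (th * s)).
  have -> : (th + 32 * th ^+ 2 * s) * dotp v v + 2 * (th * s) =
      th * dotp v v + (2 * a + 2 * u) by rewrite /a /u; ring.
  rewrite expRD -/c0 -[leLHS]mulrA ler_pM2l// expRD.
  have h1 : 1 <= expR (2 * a) by rewrite -[leLHS]expR0 ler_expR mulr_ge0.
  have h2 : 1 <= expR (2 * u) by rewrite -[leLHS]expR0 ler_expR mulr_ge0.
  move: h1 h2; set p := expR _; set q := expR _ => h1 h2.
  have : 0 <= (p - 1) * (q - 1) by apply: mulr_ge0; lra.
  lra.
have E2u := expR_ge0 (2 * u); have E2a := expR_ge0 (2 * a).
have c2 : 0 <= c0 / 2 by rewrite divr_ge0// ltW.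
have bound z := le_trans (step1 z) (ler_wpM2l c2
  (lerD (linear_exponential_bound a0 (w0 z) (step3 z)) (step2 z))).
have [ha|ha] := boolP (2 * a <= 1).
  exists (c0 / 2 * (4 * th)), (c0 / 2 * (expR (2 * a) * (2 * a) +
    expR (2 * u) * (2 * u))), (c0 / 2 * (expR (2 * a) * (1 - 2 * a) +
    expR (2 * u) * (1 - 2 * u))); split.
  - by rewrite mulr_ge0 ?divr_ge0 ?(ltW c00)// addr_ge0// mulr_ge0// mulr_ge0.
  - by apply: le_trans total; rewrite le_eqVlt; apply/orP; left; apply/eqP; ring.
  - move=> z; apply: le_trans (bound z) _; rewrite ha.
    by rewrite le_eqVlt; apply/orP; left; apply/eqP; ring.
exists 0, (c0 / 2 * (expR (2 * a) * (1 / 2) + expR (2 * u) * (2 * u))),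
  (c0 / 2 * (expR (2 * a) * (1 / 2) + expR (2 * u) * (1 - 2 * u))); split.
- by rewrite mulr_ge0 ?divr_ge0 ?(ltW c00)// addr_ge0// mulr_ge0// mulr_ge0.
- by apply: le_trans total; rewrite le_eqVlt; apply/orP; left; apply/eqP; field.
- move=> z; apply: le_trans (bound z) _; rewrite (negbTE ha).
  by rewrite le_eqVlt; apply/orP; left; apply/eqP; ring.
Qed.

End OneStep.

Section OneStepIntegral.
Variables (R : realType) (d : nat) (dX : measure_display).
Variables (X : measurableType dX) (D : probability X R).
Variables (G : X -> 'rV[R]_d) (m : 'rV[R]_d) (s : R).
Hypothesis mG : forall j, measurable_fun [set: X] (fun w => G w 0 j).
Hypothesis meanG : forall j, (\int[D]_w (G w 0 j)%:E = (m 0 j)%:E)%E.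
Hypothesis s_gt0 : 0 < s.
Hypothesis tailG :
  (\int[D]_w (expR (dotp (G w - m) (G w - m) / s))%:E <= (expR 1)%:E)%E.

Let z w : 'rV[R]_d := G w - m.

Let integral_cstP (r : R) : (\int[D]_w (EFin \o cst r) w = r%:E)%E.
Proof. by have := expectation_cst D r; rewrite unlock. Qed.

Let mz j : measurable_fun [set: X] (fun w => z w 0 j).
Proof. by under eq_fun do rewrite !mxE; exact: measurable_funD. Qed.

Let mzz : measurable_fun [set: X] (fun w => dotp (z w) (z w)).
Proof. by apply: measurable_sum => j; exact: measurable_funM. Qed.

Let mE : measurable_fun [set: X] (fun w => expR (dotp (z w) (z w) / s)).
Proof. by apply: measurableT_comp => //; exact: measurable_funM. Qed.

Let intE : D.-integrable setT (EFin \o (fun w => expR (dotp (z w) (z w) / s))).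
Proof.
apply/integrableP; split; first exact/measurable_EFinP.
under eq_integral do rewrite /= ger0_norm ?expR_ge0//.
by apply: le_lt_trans tailG _; exact: ltry.
Qed.

Let intz j : D.-integrable setT (EFin \o (fun w => z w 0 j)).
Proof.
apply: (@le_integrable _ _ _ _ _ measurableT _
  (fun w => ((1 + s)%:E * (expR (dotp (z w) (z w) / s))%:E)%E)).
- exact/measurable_EFinP.
- move=> w _; rewrite /= lee_fin [leRHS]ger0_norm; last first.
    by rewrite mulr_ge0 ?expR_ge0// addr_ge0// ltW.
  have h1 : z w 0 j ^+ 2 <= dotp (z w) (z w).
    rewrite /dotp (bigD1 j)//= -expr2 lerDl.
    by apply: sumr_ge0 => i _; rewrite -expr2 sqr_ge0.
  have h2 : `|z w 0 j| <= 1 + z w 0 j ^+ 2.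
    have := sqr_ge0 (`|z w 0 j| - 1); have := sqr_ge0 (z w 0 j).
    by rewrite -(real_normK (num_real (z w 0 j))); lra.
  have h3 := expR_ge1Dx (dotp (z w) (z w) / s).
  have h4 : 0 <= dotp (z w) (z w) / s by rewrite divr_ge0 ?dotp_ge0// ltW.
  have E : dotp (z w) (z w) = s * (dotp (z w) (z w) / s).
    by field; rewrite lt0r_neq0.
  move: h1 h2 h3 h4 E; set q := _ / s; set e := expR _ => h1 h2 h3 h4 E.
  have : s * q <= s * e by rewrite ler_pM2l//; lra.
  lra.
- exact: integrableZl.
Qed.

Let meanz j : (\int[D]_w (z w 0 j)%:E = 0)%E.
Proof.
have icst : D.-integrable setT (EFin \o cst (m 0 j)).
  exact: finite_measure_integrable_cst.
have iG : D.-integrable setT (EFin \o (fun w => G w 0 j)).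
  have -> : EFin \o (fun w => G w 0 j) =
      (EFin \o (fun w => z w 0 j)) \+ (EFin \o cst (m 0 j)).
    by apply/funext => w /=; rewrite -EFinD /z !mxE subrK.
  exact: integrableD.
under eq_integral do rewrite /z !mxE EFinB.
rewrite (integralB_EFin measurableT iG icst) meanG.
by rewrite integral_cstP subee.
Qed.

(** Integrate [exp_sqr_norm_bound]: the linear part vanishes because [G - m] is
centered, and [exp (|G - m|^2 / s - 1)] has mean at most 1. *)
Lemma exp_sqr_norm_step (v : 'rV[R]_d) (th : R) :
  0 <= th -> 2 * (th * s) <= 1 ->
  (\int[D]_w (expR (th * dotp (v + (G w - m)) (v + (G w - m))))%:E <=
   (expR ((th + 32 * th ^+ 2 * s) * dotp v v + 2 * (th * s)))%:E)%E.
Proof.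
move=> th0 ths; have [b [A [B [A0 AB bnd]]]] :=
  @exp_sqr_norm_bound R d v th s th0 s_gt0 ths.
pose lin w := (\sum_j (b * v 0%R j)%:E * (z w 0%R j)%:E)%E.
pose f w := ((A * expR (- 1))%:E * (expR (dotp (z w) (z w) / s))%:E)%E.
have mvz j : measurable_fun [set: X] (fun w => (v + z w) 0%R j).
  by under eq_fun do rewrite mxE; exact: measurable_funD.
have ilin : D.-integrable setT lin.
  by apply: integrable_sum => // j _; exact: (integrableZl measurableT _ (intz j)).
have iff : D.-integrable setT f by exact: (integrableZl measurableT _ intE).
have iB : D.-integrable setT (EFin \o cst B).
  exact: finite_measure_integrable_cst.
have iall : D.-integrable setT (fun w => (lin w + f w + (EFin \o cst B) w)%E).
  by apply: integrableD => //; exact: integrableD.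
apply: (@le_trans _ _ (\int[D]_w (lin w + f w + (EFin \o cst B) w))%E).
  apply: ge0_le_integral => //.
  - apply/measurable_EFinP/measurableT_comp => //; apply: measurable_funM => //.
    by apply: measurable_sum => j; exact: measurable_funM.
  - by case/integrableP: iall.
  - move=> w _; rewrite /lin /f -!EFinM.
    under eq_bigr do rewrite -EFinM.
    rewrite sumEFin -!EFinD lee_fin; apply: le_trans (bnd (z w)) _.
    rewrite /dotp mulr_sumr expRD lerD2r [X in _ <= _ + X]mulrAC -mulrA.
    by under eq_bigr do rewrite mulrA.
rewrite integralD//; last exact: integrableD.
rewrite integralD// integral_sum//; last first.
  by move=> j; exact: (integrableZl measurableT _ (intz j)).
rewrite big1 => [|j _]; last first.
  by rewrite (integralZl measurableT (intz j)) [X in (_ * X)%E]meanz mule0.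
rewrite add0e (integralZl measurableT intE) integral_cstP.
apply: (@le_trans _ _ ((A * expR (- 1))%:E * (expR 1)%:E + B%:E)%E).
  apply: leeD2r; apply: lee_wpmul2l; last exact: tailG.
  by rewrite lee_fin mulr_ge0 ?expR_ge0.
by rewrite -EFinM -EFinD lee_fin -(mulrA A) -expRD addNr expR0 mulr1.
Qed.

End OneStepIntegral.

(** * Borel measurability of vector-valued functions *)

Section BorelVectors.
Variables (R : realType) (d : nat).

Lemma continuous_borel_measurable (f : 'rV[R]_d -> R) :
  continuous f -> measurable_fun [set: borel_rV R d] f.
Proof.
move=> cf; apply: (measurability _ (RGenOpens.measurableE R)) => //.
move=> _ [_ [a [b ->]] <-]; rewrite setTI; apply: sub_sigma_algebra.
move: cf => /continuousP; apply; exact: interval_open.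
Qed.

(** An open set is the union of the boxes it contains that have a rational
center and a radius [1 / (n + 1)]: there are countably many of them, and the
preimage of a box is a finite intersection of conditions on the coordinates. *)
Lemma borel_measurable_coord dT (T : measurableType dT) (f : T -> 'rV[R]_d) :
  (forall j, measurable_fun setT (fun w => f w 0 j)) ->
  measurable_fun setT (f : T -> borel_rV R d).
Proof.
move=> mf; apply: (@measurability _ _ _ (borel_rV R d) _ _ open) => //.
move=> _ [U oU <-]; rewrite setTI.
pose box (q : 'rV[rat]_d) (n : nat) : set 'rV[R]_d :=
  [set x | forall j, `|ratr (q 0 j) - x 0 j| < n.+1%:R^-1].
pose V (qn : 'rV[rat]_d * nat) :=
  if `[< box qn.1 qn.2 `<=` U >] then f @^-1` box qn.1 qn.2 else set0.
have -> : f @^-1` U = \bigcup_qn V qn.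
  apply/seteqP; split => [w /= Uw|w [qn _]]; last first.
    by rewrite /V; case: asboolP => // h /= /h.
  have /nbhs_ballP[e /= e0 eU] := open_nbhs_nbhs (conj oU Uw).
  have e20 : 0 < e / 2 by rewrite divr_gt0.
  have [n _ /(_ n (leqnn _)) /= ne] := near_infty_natSinv_lt (PosNum e20).
  have pn : (0 : R) < n.+1%:R^-1 by rewrite invr_gt0.
  have /choice[q hq] : forall j, exists q : rat,
      `|ratr q - f w 0 j| < n.+1%:R^-1.
    move=> j; have [q] := @rat_in_itvoo R (f w 0 j) (f w 0 j + n.+1%:R^-1)
      (ltr_pwDr pn (lexx _)).
    rewrite in_itv /= => /andP[q1 q2]; exists q.
    by rewrite ger0_norm ?subr_ge0 ?ltW// ltrBlDl.
  exists (\row_j q j, n) => //; rewrite /V /=.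
  have -> : `[< box (\row_j q j) n `<=` U >].
    apply/asboolP => x bx; apply: eU; split => // i j.
    rewrite ord1 /ball /= -(subrKA (ratr (q j))).
    have := bx j; rewrite mxE => bxj.
    apply: le_lt_trans (ler_normD _ _) _.
    have := hq j; rewrite distrC => hqj.
    rewrite (splitr e); apply: ltrD; first exact: lt_trans hqj ne.
    exact: lt_trans bxj ne.
  by move=> /= j; rewrite mxE.
apply: countable_bigcupT_measurable => // -[q n]; rewrite /V /=.
case: asboolP => // _.
have -> : f @^-1` box q n =
    \bigcap_(j in [set: 'I_d]) [set w | `|ratr (q 0 j) - f w 0 j| < n.+1%:R^-1].
  by apply/seteqP; split => w h j; [move=> _; exact: h|exact: h].
apply: fin_bigcap_measurable; first exact: finite_finset.
move=> j _; rewrite -[X in measurable X]setTI.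
have -> : [set w | `|ratr (q 0 j) - f w 0 j| < n.+1%:R^-1] =
    (fun w => `|ratr (q 0 j) - f w 0 j|) @^-1` `]-oo, n.+1%:R^-1[.
  by apply/seteqP; split => w /=; rewrite in_itv.
have mh : measurable_fun setT (fun w => `|ratr (q 0 j) - f w 0 j|).
  by apply: measurableT_comp => //; exact: measurable_funB.
exact: mh.
Qed.

Lemma borel_coord_measurable j :
  measurable_fun [set: borel_rV R d] (fun x : 'rV[R]_d => x 0 j).
Proof. by apply: continuous_borel_measurable; exact: coord_continuous. Qed.

Lemma measurable_coord dT (T : measurableType dT) (f : T -> 'rV[R]_d) :
  measurable_fun setT (f : T -> borel_rV R d) ->
  forall j, measurable_fun setT (fun w => f w 0 j).
Proof.
move=> mf j.
by apply: (measurableT_comp (f := fun x : borel_rV R d => (x : 'rV[R]_d) 0 j))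
  => //; exact: borel_coord_measurable.
Qed.

(** A directional derivative is a pointwise limit of difference quotients. *)
Lemma measurable_grad (f : 'rV[R]_d -> R) : (forall x, differentiable f x) ->
  forall j, measurable_fun [set: borel_rV R d] (fun x => grad f x 0 j).
Proof.
move=> df j; have cf : continuous f.
  by move=> x; exact: differentiable_continuous.
pose e : 'rV[R]_d := delta_mx 0 j.
apply: (measurable_fun_cvg (h := fun n (x : borel_rV R d) =>
  n.+1%:R * (f (n.+1%:R^-1 *: e + x) - f x))).
- move=> n; apply: measurable_funM => //; apply: measurable_funB.
    apply: continuous_borel_measurable => x; apply: continuous_comp.
      by apply: continuousD; [exact: cst_continuous|exact: id].
    exact: cf.
  exact: continuous_borel_measurable.
- move=> x _; rewrite mxE.
  have /= der := @diff_derivable _ _ _ f x e (df x).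
  pose u n : R := n.+1%:R^-1.
  rewrite (_ : (fun n => _) =
    (fun h : R => h^-1 *: ((f \o shift x) (h *: e) - f x)) \o u); last first.
    by apply/funext => n /=; rewrite /u invrK.
  apply: cvg_comp der => A [r /= r0 rA].
  have [n _ nP] := near_infty_natSinv_lt (PosNum r0).
  exists n => // k nk; apply: rA => /=.
    by rewrite /u sub0r normrN gtr0_norm ?invr_gt0//; exact: nP.
  by rewrite /u invr_neq0.
Qed.

End BorelVectors.

Section MeasurableVectors.
Variables (R : realType) (d : nat) (dT : measure_display) (T : measurableType dT).
Implicit Types u v : T -> 'rV[R]_d.

Definition measurable_rV u :=
  forall j, measurable_fun [set: T] (fun w => u w 0 j).

Lemma measurable_rVD u v : measurable_rV u -> measurable_rV v ->
  measurable_rV (fun w => u w + v w).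
Proof.
by move=> mu mv j; under eq_fun do rewrite mxE; exact: measurable_funD.
Qed.

Lemma measurable_rVZ (a : R) u : measurable_rV u ->
  measurable_rV (fun w => a *: u w).
Proof.
by move=> mu j; under eq_fun do rewrite mxE; exact: measurable_funM.
Qed.

Lemma measurable_rVN u : measurable_rV u -> measurable_rV (fun w => - u w).
Proof.
move=> mu; have -> : (fun w => - u w) = (fun w => -1 *: u w).
  by apply/funext => w; rewrite scaleN1r.
exact: measurable_rVZ.
Qed.

Lemma measurable_rV_sum (I : Type) (s : seq I) (u : I -> T -> 'rV[R]_d) :
  (forall i, measurable_rV (u i)) ->
  measurable_rV (fun w => \sum_(i <- s) u i w).
Proof.
move=> mu j; under eq_fun do rewrite summxE.
by apply: measurable_sum => i; exact: mu.
Qed.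

Lemma measurable_dotp u v : measurable_rV u -> measurable_rV v ->
  measurable_fun [set: T] (fun w => dotp (u w) (v w)).
Proof. by move=> mu mv; apply: measurable_sum => j; exact: measurable_funM. Qed.

Lemma measurable_rV_comp dX (X : measurableType dX)
    (h : 'rV[R]_d -> X -> 'rV[R]_d) u (x : T -> X) :
  measurable_oracle h -> measurable_rV u -> measurable_fun setT x ->
  measurable_rV (fun w => h (u w) (x w)).
Proof.
move=> mh mu mx; apply: measurable_coord.
apply: (measurableT_comp (f := fun p : borel_rV R d * X =>
  (h p.1 p.2 : borel_rV R d)) mh (g := fun w => (u w : borel_rV R d, x w))).
by apply: measurable_fun_pair => //; exact: borel_measurable_coord.
Qed.

End MeasurableVectors.

Section Iterates.
Variables (R : realType) (d M H : nat) (dX : 'I_M -> measure_display).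
Variables (X : forall i, measurableType (dX i)).
Variables (g : forall i, 'rV[R]_d -> X i -> 'rV[R]_d) (alpha : R).
Variables (x0 : 'rV[R]_d).
Hypothesis mg : forall i, measurable_oracle (@g i).

(** The sample space is arbitrary because the lemma serves both the ambient
sigma-algebra and the smaller one that forgets a given sample. *)
Lemma measurable_batched_FL dT (T : measurableType dT)
    (xi : forall i, nat -> T -> X i) (k : nat) :
  (forall i t, (t < k * H)%N -> measurable_fun setT (xi i t)) ->
  measurable_rV (fun w => batched_FL H g alpha x0 (fun i t => xi i t w) k).
Proof.
elim: k => [|k IH] mxi /=; first by move=> j; exact: measurable_cst.
have {}IH : measurable_rV
    (fun w => batched_FL H g alpha x0 (fun i t => xi i t w) k).
  by apply: IH => i t tk; apply: mxi; rewrite mulSn ltn_addl.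
apply: measurable_rVZ; apply: measurable_rV_sum => i.
apply: measurable_rVD => //; apply: measurable_rVN; apply: measurable_rVZ.
apply: measurable_rVZ; apply: measurable_rV_sum => l.
apply: measurable_rV_comp => //; apply: mxi.
by rewrite mulSn addnC ltn_add2r.
Qed.

End Iterates.

(** * Independence of one sample from all the others *)

Section IndependentOfTheRest.
Variables (R : realType) (dO : measure_display) (Omega : measurableType dO).
Variables (P : probability Omega R) (I : finType).
Variable F : I -> set (set Omega).
Hypothesis F_measurable : forall p A, F p A -> measurable A.
Hypothesis F_setI : forall p A B, F p A -> F p B -> F p (A `&` B).
Hypothesis F_setT : forall p, F p setT.
Hypothesis product_rule : forall A : I -> set Omega, (forall p, F p (A p)) ->
  (P (\bigcap_p A p) = \prod_p P (A p))%E.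

(** A pi-system generating the sigma-algebra of all the indices but [q]. *)
Definition events_without (q : I) : set (set Omega) :=
  [set E | exists A : I -> set Omega,
     [/\ forall p, F p (A p), A q = setT & E = \bigcap_p A p]].

Lemma events_without_measurable q E : events_without q E -> measurable E.
Proof.
case=> A [FA _ ->]; apply: fin_bigcap_measurable; first exact: finite_finset.
by move=> p _; exact: F_measurable (FA p).
Qed.

Lemma events_without_setI q : setI_closed (events_without q).
Proof.
move=> _ _ [A [FA Aq ->]] [B [FB Bq ->]].
exists (fun p => A p `&` B p); split.
- by move=> p; exact: F_setI.
- by rewrite Aq Bq setIT.
- by rewrite -bigcapI.
Qed.

Lemma events_without_setT q : events_without q setT.
Proof.
exists (fun=> setT); split=> //.
by apply/seteqP; split.
Qed.

Lemma sub_events_without q p A : p != q -> F p A -> events_without q A.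
Proof.
move=> pq FA; exists (fun r => if r == p then A else setT); split.
- by move=> r; case: eqP => [->|].
- by rewrite eq_sym (negbTE pq).
- apply/seteqP; split => [w Aw r _|w /(_ p Logic.I)]; last by rewrite eqxx.
  by case: ifP.
Qed.

(** The two finite measures [A |-> P (A n B)] and [A |-> P B * P A] agree on the
pi-system of events that leave the index [q] unconstrained. *)
Lemma independent_of_the_rest q A B :
  <<s events_without q >> A -> F q B -> (P (A `&` B) = P A * P B)%E.
Proof.
move=> sA FB; have mB := F_measurable FB.
have PBfin : P B \is a fin_num by exact: fin_num_measure.
have PB0 : 0 <= fine (P B) by exact: fine_ge0.
pose m1 : {measure set Omega -> \bar R} := mrestr P mB.
pose m2 : {measure set Omega -> \bar R} := mscale (NngNum PB0) P.
have m1E U : m1 U = P (U `&` B) by [].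
have m2E U : m2 U = (P B * P U)%E by rewrite -[X in (X * _)%E]fineK.
suff : m1 A = m2 A by rewrite m1E m2E muleC.
apply: (g_sigma_algebra_measure_unique (events_without q) _ (fun=> setT)) => //.
- exact: events_without_measurable.
- by move=> _; exact: events_without_setT.
- by rewrite bigcup_const.
- exact: events_without_setI.
- move=> _ [A' [FA' A'q ->]]; rewrite m1E m2E.
  pose C p := if p == q then B else A' p.
  have FC p : F p (C p) by rewrite /C; case: eqP => [->|].
  have -> : \bigcap_p A' p `&` B = \bigcap_p C p.
    apply/seteqP; split => [w [Aw Bw] p _|w Cw].
      by rewrite /C; case: eqP => // _; exact: Aw.
    split; last by have := Cw q Logic.I; rewrite /C eqxx.
    move=> p _; have := Cw p Logic.I; rewrite /C.
    by case: eqP => [-> _|//]; rewrite A'q.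
  rewrite !product_rule// (bigD1 q)//= [in RHS](bigD1 q)//= /C eqxx A'q.
  rewrite probability_setT mul1e; congr (_ * _)%E.
  by apply: eq_bigr => p /negbTE ->.
- move=> _; rewrite m1E setTI; apply: le_lt_trans (ltry 1).
  exact: probability_le1.
Qed.

End IndependentOfTheRest.

Section Freezing.
Variables (R : realType) (dO dX : measure_display) (Omega : measurableType dO).
Variables (P : probability Omega R) (X : measurableType dX).
Variables (D : probability X R) (xi : Omega -> X) (C : set (set Omega)).
Hypothesis xi_measurable : measurable_fun setT xi.
Hypothesis C_measurable : C `<=` @measurable _ Omega.
Hypothesis indep : forall A B, <<s C >> A -> measurable B ->
  (P (A `&` xi @^-1` B) = P A * D B)%E.

Let E : measurableType C.-sigma := g_sigma_algebraType C.

Let id_measurable : measurable_fun setT (id : Omega -> E).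
Proof.
move=> _ A mA; rewrite setTI; move: A mA; apply: smallest_sub => //.
exact: sigma_algebra_measurable.
Qed.

Let pair_measurable : measurable_fun setT ((fun w => (w, xi w)) : Omega -> E * X).
Proof. exact: measurable_fun_pair. Qed.

(** Independence freezes the past: a sample that is independent of the
sub-sigma-algebra generated by [C] may be integrated out first, because the
joint law of the past and the sample is a product measure. *)
Lemma integral_freeze (h : Omega -> X -> \bar R) :
  measurable_fun [set: E * X] (fun p => h p.1 p.2) ->
  (forall w x, 0 <= h w x)%E ->
  (\int[P]_w h w (xi w) = \int[P]_w \int[D]_x h w x)%E.
Proof.
move=> mh h0.
pose idm : {RV P >-> E} := HB.pack (id : Omega -> E)
  (isMeasurableFun.Build _ _ _ _ _ id_measurable).
pose prm : {RV P >-> (E * X)%type} := HB.pack ((fun w => (w, xi w)) : Omega -> E * X)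
  (isMeasurableFun.Build _ _ _ _ _ pair_measurable).
have prodE (U : set (E * X)) : measurable U ->
    (distribution P idm \x D)%E U = distribution P prm U.
  apply: product_measure_unique => A B mA mB.
  rewrite /distribution /pushforward /=; exact: indep.
transitivity (\int[distribution P prm]_p h p.1 p.2)%E.
  by rewrite ge0_integral_distribution.
transitivity (\int[(distribution P idm \x D)%E]_p h p.1 p.2)%E.
  by apply: eq_measure_integral => U mU _; exact/esym/prodE.
rewrite fubini_tonelli1//= ge0_integral_distribution//.
  exact: measurable_fun_fubini_tonelli_F.
by move=> w; apply: integral_ge0.
Qed.

Lemma le_integral_freeze (h : Omega -> X -> \bar R) (c : Omega -> \bar R) :
  measurable_fun [set: E * X] (fun p => h p.1 p.2) ->
  (forall w x, 0 <= h w x)%E -> measurable_fun setT c ->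
  (forall w, \int[D]_x h w x <= c w)%E ->
  (\int[P]_w h w (xi w) <= \int[P]_w c w)%E.
Proof.
move=> mh h0 mc hc; rewrite integral_freeze//; apply: ge0_le_integral => //.
  by move=> w _; exact: integral_ge0.
apply: (measurableT_comp (f := fun w : E => (\int[D]_x h w x)%E) _ id_measurable).
exact: (@measurable_fun_fubini_tonelli_F _ _ E X R D (fun p => h p.1 p.2) mh
  (fun p => h0 p.1 p.2)).
Qed.

End Freezing.

(** * Noise of one communication round *)

Section SampleIndependence.
Variables (R : realType) (M T : nat) (dX : 'I_M -> measure_display).
Variables (X : forall i, measurableType (dX i)).
Variables (dO : measure_display) (Omega : measurableType dO).
Variables (P : probability Omega R) (xi : forall i, nat -> {RV P >-> X i}).

Definition sample_events (p : 'I_M * 'I_T) : set (set Omega) :=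
  g_sigma_algebra_preimage (xi p.1 p.2).

Lemma sample_events_measurable p A : sample_events p A -> measurable A.
Proof. by case=> B mB <-; exact: measurable_funPT. Qed.

Lemma sample_events_setI p A B :
  sample_events p A -> sample_events p B -> sample_events p (A `&` B).
Proof.
case=> A' mA <- [B' mB <-]; exists (A' `&` B'); first exact: measurableI.
by rewrite !setTI preimage_setI.
Qed.

Lemma sample_events_setT p : sample_events p setT.
Proof. by exists setT => //; rewrite setTI preimage_setT. Qed.

Lemma sample_events_preimage p B : measurable B ->
  sample_events p (xi p.1 p.2 @^-1` B).
Proof. by move=> mB; exists B => //; rewrite setTI. Qed.

(** Group the intersection by agent.  The part of one agent lies in the
sigma-algebra of its process, so the agents factor first, and the times of each
agent factor next. *)
Lemma sample_events_product_rule :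
  (forall i, mutually_independent P
     (fun t : 'I_T => g_sigma_algebra_preimage (xi i t))) ->
  mutually_independent P (fun i => process_sigma_algebra T (xi i)) ->
  forall A : 'I_M * 'I_T -> set Omega, (forall p, sample_events p (A p)) ->
  (P (\bigcap_p A p) = \prod_p P (A p))%E.
Proof.
move=> ind_time ind_agents A FA.
pose B i := \bigcap_(t in [set` [set: 'I_T]%SET]) A (i, t).
have -> : \bigcap_p A p = \bigcap_(i in [set` [set: 'I_M]%SET]) B i.
  apply/seteqP; split => [w Aw i _ t _|w Bw [i t] _]; first exact: Aw.
  by apply: (Bw i) => /=; rewrite inE.
rewrite ind_agents => [|i _].
  under eq_bigr => i _.
    rewrite (ind_time i _ (fun t => A (i, t))) => [|t _]; last exact: (FA (i, t)).
    under eq_bigl do rewrite inE.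
    over.
  under eq_bigl do rewrite inE.
  rewrite (pair_bigA _ (fun i t => P (A (i, t)))) /=.
  by apply: eq_bigr => -[].
rewrite /process_sigma_algebra.
set gens := \bigcup_(t in _) _.
apply: (@fin_bigcap_measurable _ (g_sigma_algebraType gens)) => // t _.
apply: sub_sigma_algebra; exists (t : nat); first exact: ltn_ord.
exact: (FA (i, t)).
Qed.

End SampleIndependence.

Section RoundNoise.
Variables (R : realType) (d M H T : nat).
Variables (f : 'I_M -> 'rV[R]_d -> R) (s alpha : R) (x0 : 'rV[R]_d).
Variables (dX : 'I_M -> measure_display) (X : forall i, measurableType (dX i)).
Variables (D : forall i, probability (X i) R).
Variables (g : forall i, 'rV[R]_d -> X i -> 'rV[R]_d).
Variables (dO : measure_display) (Omega : measurableType dO).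
Variables (P : probability Omega R) (xi : forall i, nat -> {RV P >-> X i}).
Hypothesis df : forall i x, differentiable (f i) x.
Hypothesis mg : forall i, measurable_oracle (@g i).
Hypothesis law : forall i t, (t < T)%N ->
  forall B, measurable B -> P (xi i t @^-1` B) = D i B.
Hypothesis product_rule : forall A : 'I_M * 'I_T -> set Omega,
  (forall p, sample_events xi p (A p)) ->
  (P (\bigcap_p A p) = \prod_p P (A p))%E.
Hypothesis s_gt0 : 0 < s.
Hypothesis unbiased : forall i x j,
  (\int[D i]_y (g x y 0%R j)%:E = (grad (f i) x 0%R j)%:E)%E.
Hypothesis light_tail : forall i x,
  (\int[D i]_y (expR (dotp (@g i x y - grad (f i) x)
     (@g i x y - grad (f i) x) / s))%:E <= (expR 1)%:E)%E.

Variable k : nat.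
Hypothesis kT : (k.+1 * H <= T)%N.

Definition iterate (w : Omega) :=
  batched_FL H g alpha x0 (fun i t => xi i t w) k.

Definition sample_noise (p : 'I_M * 'I_H) (w : Omega) : 'rV[R]_d :=
  g (iterate w) (xi p.1 (k * H + p.2)%N w) - grad (f p.1) (iterate w).

Lemma round_time_lt (l : 'I_H) : (k * H + l < T)%N.
Proof. by apply: leq_trans kT; rewrite mulSn addnC ltn_add2r. Qed.

Definition sample_index (p : 'I_M * 'I_H) : 'I_M * 'I_T :=
  (p.1, Ordinal (round_time_lt p.2)).

Lemma sample_index_inj : injective sample_index.
Proof.
move=> [i l] [i' l'] [-> /eqP]; rewrite eqn_add2l => /eqP /ord_inj ->.
by [].
Qed.

(** The map [to_Omega] only changes the sigma-algebra: it is the identity in all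
uses, with either the ambient one or the one that forgets a given sample on
its source. *)
Section OverSampleSpace.
Variables (dT : measure_display) (Om : measurableType dT) (to_Omega : Om -> Omega).

Lemma measurable_iterate :
  (forall i t, (t < k * H)%N -> measurable_fun setT (xi i t \o to_Omega)) ->
  measurable_rV (iterate \o to_Omega).
Proof.
move=> mxi.
exact: (measurable_batched_FL alpha x0 mg (xi := fun i t => xi i t \o to_Omega)).
Qed.

Lemma measurable_sample_noise (p : 'I_M * 'I_H) :
  (forall i t, (t < k * H)%N -> measurable_fun setT (xi i t \o to_Omega)) ->
  measurable_fun setT (xi p.1 (k * H + p.2)%N \o to_Omega) ->
  measurable_rV (sample_noise p \o to_Omega).
Proof.
move=> mpast mp; apply: measurable_rVD.
  by apply: measurable_rV_comp => //; exact: measurable_iterate.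
apply: measurable_rVN => j.
apply: (measurableT_comp (f := fun x : borel_rV R d => grad (f p.1) x 0 j)
  (g := (iterate \o to_Omega : Om -> borel_rV R d))).
  exact: measurable_grad.
apply: borel_measurable_coord; exact: measurable_iterate.
Qed.

End OverSampleSpace.

Definition partial_noise (ps : seq ('I_M * 'I_H)) (w : Omega) :=
  \sum_(p <- ps) sample_noise p w.

Lemma measurable_partial_noise ps : measurable_rV (partial_noise ps).
Proof.
apply: measurable_rV_sum => p.
by apply: (measurable_sample_noise (to_Omega := id)).
Qed.

(** Induction on the samples, the last one being integrated first: the exponent
[u = th s] becomes [u + 32 u^2], and the condition [64 n u <= 1] propagates to
one sample fewer because [64 (n - 1) (u + 32 u^2) <= 1 - 32 u].  It also makes
the costs [2 u] add up to at most [4 n u]. *)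
Lemma integral_exp_partial_noise ps (th : R) : uniq ps -> 0 <= th ->
  64 * (size ps)%:R * (th * s) <= 1 ->
  (\int[P]_w (expR (th * dotp (partial_noise ps w)
                             (partial_noise ps w)))%:E <=
   (expR (4 * (size ps)%:R * (th * s)))%:E)%E.
Proof.
elim: ps th => [|q ps IH] th /=.
  move=> _ th0 _.
  under eq_integral do rewrite /partial_noise big_nil dotp0l mulr0.
  rewrite mulr0 mul0r; have := expectation_cst P (expR 0 : R).
  by rewrite unlock => ->.
move=> /andP[qps ups] th0 hth.
have s0 := s_gt0; have u0 : 0 <= th * s by rewrite mulr_ge0// ltW.
have n0 : 0 <= (size ps)%:R :> R by [].
have En : (size ps).+1%:R = (size ps)%:R + 1 :> R by rewrite natr1.
rewrite {}En in hth *.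
have nu0 : 0 <= (size ps)%:R * (th * s) by rewrite mulr_ge0.
have hu : 2 * (th * s) <= 1 by lra.
pose th' := th + 32 * th ^+ 2 * s.
have E' : th' * s = th * s + 32 * (th * s) ^+ 2 by rewrite /th'; ring.
have th'0 : 0 <= th'.
  by rewrite addr_ge0// mulr_ge0 ?(ltW s0)// mulr_ge0 ?sqr_ge0.
set S := partial_noise ps.
pose C := events_without (sample_events xi (T := T)) (sample_index q).
pose h (w : Omega) (y : X q.1) := (expR (th * dotp
  (S w + (g (iterate w) y - grad (f q.1) (iterate w)))
  (S w + (g (iterate w) y - grad (f q.1) (iterate w)))))%:E.
have mxi (p : 'I_M * 'I_T) : p != sample_index q ->
    measurable_fun [set: g_sigma_algebraType C] (xi p.1 p.2).
  move=> pq _ B mB; rewrite setTI; apply: sub_sigma_algebra.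
  apply: (sub_events_without _ pq); first exact: sample_events_setT.
  exact: sample_events_preimage.
have mpast i t : (t < k * H)%N ->
    measurable_fun [set: g_sigma_algebraType C] (xi i t).
  move=> tk; have tT : (t < T)%N.
    by apply: leq_trans tk _; apply: leq_trans kT; rewrite mulSn leq_addl.
  apply: (mxi (i, Ordinal tT)); apply/eqP => -[_ E].
  by move: tk; rewrite E ltnNge leq_addr.
(* The summand of [q] is replaced by 0 so that all the summands are measurable
   without the sample [q]; it does not occur in [ps]. *)
have mS : measurable_rV (S : g_sigma_algebraType C -> _).
  have : measurable_rV (fun w : g_sigma_algebraType C =>
      \sum_(p <- ps) if p == q then 0 else sample_noise p w).
    apply: measurable_rV_sum => p; case: eqP => [_ j|/eqP pq].
      exact: measurable_cst.
    apply: (@measurable_sample_noise _ (g_sigma_algebraType C) id p) => //.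
    by apply: (mxi (sample_index p)); rewrite (inj_eq sample_index_inj).
  congr measurable_rV; apply/funext => w; rewrite /S /partial_noise.
  rewrite !big_seq; apply: eq_bigr => p pps; case: eqP => // pq.
  by move: pps; rewrite pq (negbTE qps).
have mh : measurable_fun [set: g_sigma_algebraType C * X q.1]
    (fun p => h p.1 p.2).
  apply/measurable_EFinP/measurableT_comp => //; apply: measurable_funM => //.
  have mx : measurable_rV (fun p : g_sigma_algebraType C * X q.1 => iterate p.1).
    move=> j.
    apply: (measurableT_comp (f := fun w : g_sigma_algebraType C => iterate w 0 j)).
      exact: (@measurable_iterate _ (g_sigma_algebraType C) id).
    exact: measurable_fst.
  have mv : measurable_rV (fun p : g_sigma_algebraType C * X q.1 =>
      S p.1 + (g (iterate p.1) p.2 - grad (f q.1) (iterate p.1))).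
    apply: measurable_rVD.
      move=> j; apply: (measurableT_comp (f := fun w : g_sigma_algebraType C => S w 0 j)).
        exact: mS.
      exact: measurable_fst.
    apply: measurable_rVD.
      by apply: measurable_rV_comp => //; exact: measurable_snd.
    apply: measurable_rVN => j.
    apply: (measurableT_comp (f := fun x : borel_rV R d => grad (f q.1) x 0 j)).
      exact: measurable_grad.
    exact: borel_measurable_coord.
  exact: measurable_dotp.
have step : (\int[P]_w h w (xi q.1 (k * H + q.2)%N w) <=
    \int[P]_w (expR (th' * dotp (S w) (S w) + 2 * (th * s)))%:E)%E.
  apply: (@le_integral_freeze _ _ _ _ P _ (D q.1) _ C) => //.
  - move=> A; apply: events_without_measurable => p B.
    exact: sample_events_measurable.
  - move=> A B sA mB.
    rewrite (independent_of_the_rest _ _ _ product_rule sA).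
    + by rewrite law// round_time_lt.
    + by move=> p B'; exact: sample_events_measurable.
    + by move=> p A' B'; exact: sample_events_setI.
    + by move=> p; exact: sample_events_setT.
    + by have := @sample_events_preimage R M T dX X dO Omega P xi
        (sample_index q) B mB.
  - by move=> w y; rewrite lee_fin expR_ge0.
  - apply/measurable_EFinP/measurableT_comp => //; apply: measurable_funD => //.
    apply: measurable_funM => //.
    by apply: measurable_dotp; exact: measurable_partial_noise.
  - move=> w; apply: exp_sqr_norm_step => // j.
    by apply: measurable_rV_comp.
apply: le_trans (le_trans step _).
  rewrite le_eqVlt; apply/orP; left; apply/eqP; apply: eq_integral => w _.
  by rewrite /h /partial_noise big_cons addrC.
have -> : (\int[P]_w (expR (th' * dotp (S w) (S w) + 2 * (th * s)))%:E =
   (expR (2 * (th * s)))%:E * \int[P]_w (expR (th' * dotp (S w) (S w)))%:E)%E.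
  rewrite -ge0_integralZl//.
  - by apply: eq_integral => w _; rewrite addrC expRD EFinM.
  - apply/measurable_EFinP/measurableT_comp => //; apply: measurable_funM => //.
    by apply: measurable_dotp; exact: measurable_partial_noise.
have hu2 : 0 <= (th * s) * (1 - 64 * ((size ps)%:R * (th * s))).
  by apply: mulr_ge0 => //; lra.
apply: (@le_trans _ _ ((expR (2 * (th * s)))%:E *
    (expR (4 * (size ps)%:R * (th' * s)))%:E)%E).
  apply: lee_wpmul2l; first by rewrite lee_fin expR_ge0.
  apply: IH => //; rewrite E'.
  have : 0 <= (th * s) * (1 - 64 * ((size ps)%:R * (th * s) + (th * s))).
    by apply: mulr_ge0 => //; lra.
  lra.
rewrite -EFinM lee_fin -expRD ler_expR E'; lra.
Qed.

End RoundNoise.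

(** * One round as a perturbed gradient step *)

Lemma grad_global_objective (R : realType) (d M : nat)
    (f : 'I_M -> 'rV[R]_d -> R) (x : 'rV[R]_d) :
  (forall i y, differentiable (f i) y) ->
  grad (global_objective f) x = M%:R^-1 *: \sum_i grad (f i) x.
Proof.
move=> df; apply/rowP => j; rewrite !mxE summxE.
have -> : global_objective f = M%:R^-1 \*: (\sum_i f i).
  by apply/funext => y; rewrite /global_objective /= fct_sumE.
have di i : derivable (f i) x (delta_mx 0 j) by exact: diff_derivable.
rewrite deriveZ; last exact: derivable_sum.
by rewrite derive_sum//; congr (_ * _); apply: eq_bigr => i _; rewrite mxE.
Qed.

Lemma continuous_global_objective (R : realType) (d M : nat)
    (f : 'I_M -> 'rV[R]_d -> R) :
  (forall i y, differentiable (f i) y) -> continuous (global_objective f).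
Proof.
move=> df x; have -> : global_objective f = M%:R^-1 \*: (\sum_i f i).
  by apply/funext => y; rewrite /global_objective /= fct_sumE.
apply: differentiable_continuous; apply: differentiableZ.
exact: differentiable_sum.
Qed.

(** The gradient of the averaged objective is the average of the local gradients,
so centering each sample at its own local gradient takes out exactly the global
gradient. *)
Lemma batched_FL_step (R : realType) (d M H : nat)
    (f : 'I_M -> 'rV[R]_d -> R) (alpha : R) (x0 : 'rV[R]_d)
    (dX : 'I_M -> measure_display) (X : forall i, measurableType (dX i))
    (g : forall i, 'rV[R]_d -> X i -> 'rV[R]_d)
    (dO : measure_display) (Omega : measurableType dO)
    (P : probability Omega R) (xi : forall i, nat -> {RV P >-> X i})
    (k : nat) (w : Omega) :
  (0 < M)%N -> (0 < H)%N -> (forall i y, differentiable (f i) y) ->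
  iterate H alpha x0 g xi k.+1 w =
  iterate H alpha x0 g xi k w - alpha *: (grad (global_objective f)
    (iterate H alpha x0 g xi k w) + (M * H)%:R^-1 *:
    partial_noise f alpha x0 g xi k (index_enum ('I_M * 'I_H)%type) w).
Proof.
move=> M0 H0 df; rewrite grad_global_objective//.
rewrite {1}/iterate /= -/(iterate H alpha x0 g xi k w).
set x := iterate _ _ _ _ _ _ _; set dF := \sum_i grad (f i) x.
have Mn : M%:R != 0 :> R by rewrite pnatr_eq0 -lt0n.
have Hn : H%:R != 0 :> R by rewrite pnatr_eq0 -lt0n.
pose G := \sum_i \sum_(l < H) @g i x (xi i (k * H + l)%N w).
have -> : partial_noise f alpha x0 g xi k (index_enum ('I_M * 'I_H)%type) w
    = G - H%:R *: dF.
  rewrite /partial_noise /sample_noise -/x.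
  rewrite -(pair_bigA _ (fun i (l : 'I_H) =>
    @g i x (xi i (k * H + l)%N w) - grad (f i) x)) /=.
  under eq_bigr do rewrite sumrB.
  rewrite sumrB; congr (_ - _); rewrite scaler_sumr; apply: eq_bigr => i _.
  by rewrite sumr_const card_ord scaler_nat.
rewrite /local_step sumrB sumr_const card_ord scalerBr -(scaler_nat M x) scalerA.
rewrite mulVf// scale1r; congr (_ - _).
rewrite -scaler_sumr scalerA (mulrC _ alpha) -scalerA; congr (_ *: _).
rewrite /batch_gradient -scaler_sumr -/G scalerA.
rewrite scalerBr scalerA natrM invfM -[M%:R^-1 * _ * _]mulrA mulVf// mulr1.
by rewrite addrCA subrr addr0.
Qed.

(** * Convergence with high probability *)

(** The perturbation [B / (4 L)] of one step, divided by the contraction rate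
[mu / (2 L)], no longer depends on [L]. *)
Lemma perturbed_gradient_descent (R : realType) (d : nat) (F : 'rV[R]_d -> R)
    (L mu B : R) (xs : 'rV[R]_d) (x e : nat -> 'rV[R]_d) (K : nat) :
  0 < mu -> mu <= L -> 0 <= B -> strongly_convex mu F -> smooth L F ->
  (forall k, x k.+1 = x k - (1 / (2 * L)) *: (grad F (x k) + e k)) ->
  (forall k, (k < K)%N -> dotp (e k) (e k) <= B) ->
  F (x K) - F xs <= (1 - mu / (2 * L)) ^+ K * (F (x 0%N) - F xs) + B / (2 * mu).
Proof.
move=> mu0 muL B0 sc sm xE eB; have L0 : 0 < L by lra.
have -> : B / (2 * mu) = B / (4 * L) / (mu / (2 * L)).
  by field; apply/andP; split; lra.
apply: (contraction_unroll (r := fun k => F (x k) - F xs)).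
- rewrite divr_gt0//=; last lra.
  by rewrite ler_pdivrMr; lra.
- by rewrite divr_ge0//; lra.
- move=> k kK; rewrite xE.
  apply: le_trans (gradient_step mu0 sc sm (x k) (e k) xs L0) _.
  rewrite lerD2l ler_pM2r ?invr_gt0; first exact: eB.
  by rewrite mulr_gt0.
Qed.

(** The choice of [K] makes the factor at most [exp (- 2 ln N)], that is
[N^-2]; one power of [N] is enough. *)
Lemma geometric_rate (R : realType) (L mu N : R) (K : nat) :
  0 < mu -> mu <= L -> 1 <= N -> K%:R = 4 * (L / mu) * ln N ->
  (1 - mu / (2 * L)) ^+ K <= N^-1.
Proof.
move=> mu0 muL N1 KE; have L0 : 0 < L by lra.
have N0 : 0 < N by lra.
have a1 : 0 <= 1 - mu / (2 * L).
  by rewrite subr_ge0 ler_pdivrMr; lra.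
have h : 1 - mu / (2 * L) <= expR (- (mu / (2 * L))) by exact: expR_ge1Dx.
have h' : (1 - mu / (2 * L)) ^+ K <= expR (- (mu / (2 * L))) ^+ K.
  by rewrite lerXn2r ?nnegrE ?expR_ge0.
apply: (le_trans h'); rewrite -expRM_natl KE.
have -> : 4 * (L / mu) * ln N * - (mu / (2 * L)) = - ln N - ln N.
  by field; apply/andP; split; lra.
rewrite expRD expRN lnK ?posrE// -[leRHS]mulr1 ler_pM2l ?invr_gt0//.
by rewrite invf_le1.
Qed.

Section ChernoffNoise.
Variables (R : realType) (dO : measure_display) (Omega : measurableType dO).
Variables (P : probability Omega R).

Lemma exponential_markov (Y : Omega -> R) (th a b : R) : 0 < th ->
  measurable_fun setT Y ->
  (\int[P]_w (expR (th * Y w))%:E <= (expR b)%:E)%E ->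
  (P [set w | (a <= Y w)%R] <= (expR (b - th * a))%:E)%E.
Proof.
move=> th0 mY hY.
pose Y' : {RV P >-> R} := HB.pack Y (isMeasurableFun.Build _ _ _ _ _ mY).
apply: le_trans (chernoff Y' a th0) _.
rewrite expRD EFinM; apply: lee_wpmul2r; first by rewrite lee_fin expR_ge0.
apply: le_trans hY; rewrite /mmt_gen_fun unlock le_eqVlt; apply/orP; left.
by apply/eqP/eq_integral => w _ /=; rewrite mulrC.
Qed.

End ChernoffNoise.

Section NoiseTail.
Variables (R : realType) (d M H T : nat).
Variables (f : 'I_M -> 'rV[R]_d -> R) (s alpha : R) (x0 : 'rV[R]_d).
Variables (dX : 'I_M -> measure_display) (X : forall i, measurableType (dX i)).
Variables (D : forall i, probability (X i) R).
Variables (g : forall i, 'rV[R]_d -> X i -> 'rV[R]_d).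
Variables (dO : measure_display) (Omega : measurableType dO).
Variables (P : probability Omega R) (xi : forall i, nat -> {RV P >-> X i}).
Hypothesis df : forall i x, differentiable (f i) x.
Hypothesis mg : forall i, measurable_oracle (@g i).
Hypothesis iid_xi : forall i, iid P T (D i) (xi i).
Hypothesis indep : mutually_independent P (fun i => process_sigma_algebra T (xi i)).
Hypothesis s_gt0 : 0 < s.
Hypothesis unbiased : forall i, unbiased_oracle (D i) (f i) (@g i).
Hypothesis light_tail : forall i x,
  (\int[D i]_y (expR (dotp (@g i x y - grad (f i) x)
     (@g i x y - grad (f i) x) / s))%:E <= (expR 1)%:E)%E.
Hypotheses (M_gt0 : (0 < M)%N) (H_gt0 : (0 < H)%N).

(** Markov's inequality at the largest exponent that
[integral_exp_partial_noise] allows, [th = 1 / (64 n s)]; the moment there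
is at most [exp (1 / 16)]. *)
Lemma round_noise_tail (k : nat) (lam : R) : (k.+1 * H <= T)%N ->
  (P [set w | (64 * (M * H)%:R * s * lam <=
     dotp (partial_noise f alpha x0 g xi k (index_enum ('I_M * 'I_H)%type) w)
          (partial_noise f alpha x0 g xi k (index_enum ('I_M * 'I_H)%type) w))%R]
   <= (expR (1 / 16 - lam))%:E)%E.
Proof.
move=> kT; set ps := index_enum _; set n := (M * H)%:R.
have n0 : 0 < n by rewrite ltr0n muln_gt0 M_gt0.
have s0 := s_gt0.
have sz : (size ps)%:R = n.
  by rewrite /ps /n -sum1_size sum1_card card_prod !card_ord.
pose th := (64 * n * s)^-1.
have th0 : 0 < th by rewrite invr_gt0 !mulr_gt0.
have thE : n * (th * s) = 1 / 64.
  by rewrite /th; clearbody n; field; rewrite !lt0r_neq0.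
have -> : 1 / 16 - lam = 1 / 16 - th * (64 * n * s * lam).
  by rewrite /th; clearbody n; field; rewrite !lt0r_neq0.
apply: exponential_markov => //.
  by apply: measurable_dotp; exact: measurable_partial_noise.
have -> : 1 / 16 = 4 * (size ps)%:R * (th * s) :> R.
  by rewrite sz -mulrA thE; lra.
apply: (@integral_exp_partial_noise R d M H T f s alpha x0 _ X D g _ _ P xi)
  => //.
- by move=> i t tT B mB; case: (iid_xi i) => /(_ t tT B mB).
- by apply: sample_events_product_rule => // i; case: (iid_xi i).
- by move=> i x j; have := unbiased i x j; rewrite unlock.
- exact: index_enum_uniq.
- exact: ltW.
- by rewrite sz -mulrA thE; lra.
Qed.

End NoiseTail.

Theorem theorem3 (R : realType) :
  exists c : R,
  forall (d M K H T : nat)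
    (f : 'I_M -> 'rV[R]_d -> R) (L mu sigma : R) (xstar x0 : 'rV[R]_d)
    (dX : 'I_M -> measure_display) (X : forall i, measurableType (dX i))
    (D : forall i, probability (X i) R)
    (g : forall i, 'rV[R]_d -> X i -> 'rV[R]_d)
    (dO : measure_display) (Omega : measurableType dO)
    (P : probability Omega R)
    (xi : forall i, nat -> {RV P >-> X i})
    (delta : R),
  let F := global_objective f in
  let kappa := L / mu in
  let r (k : nat) (w : Omega) :=
    F (batched_FL H g (1 / (2 * L)) x0 (fun i t => xi i t w) k) - F xstar in
  (0 < d)%N -> (0 < M)%N -> (0 < K)%N -> (0 < H)%N -> T = (K * H)%N ->
  (forall i x, differentiable (f i) x) ->
  (forall x, F xstar <= F x) ->
  (forall i, measurable_oracle (g i)) ->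
  (forall i, iid P T (D i) (xi i)) ->
  smooth L F ->
  0 < mu -> strongly_convex mu F ->
  (forall i, unbiased_oracle (D i) (f i) (g i)) ->
  0 < sigma ^+ 2 -> (forall i, light_tailed_oracle (D i) (f i) (g i) sigma) ->
  mutually_independent P (fun i => process_sigma_algebra T (xi i)) ->
  0 < delta < 1 ->
  K%:R = 4 * kappa * ln (M * T)%:R ->
  ((1 - delta)%:E <=
   P [set w | (r K w <= r 0%N w / (M * T)%:R
      + 16 * c ^+ 2 * kappa * sigma ^+ 2 / (mu * (M * T)%:R)
        * ln (M * T)%:R * ln ((2 * d * T)%:R / delta))%R])%E.
Proof.
(* The noise contributes [32 sigma^2 lam / (n mu)], whereas the stated term is
   [4 c^2 sigma^2 lam / (n mu)]: any [c] with [8 <= c^2] will do. *)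
exists 3 => d M K H T f L mu sigma xstar x0 dX X D g dO Omega P xi delta F kappa r.
move=> d0 M0 K0 H0 TE df xs_min mg iid_xi smF mu0 scF unb s0 tail ind.
move=> /andP[del0 del1] KE.
set s := sigma ^+ 2 in s0 *.
have muL : mu <= L by exact: strong_convexity_le_smoothness scF smF d0.
have L0 : 0 < L by exact: lt_le_trans muL.
have T0 : (0 < T)%N by rewrite TE muln_gt0 K0.
set lam := ln ((2 * d * T)%:R / delta).
pose x k w := iterate H (1 / (2 * L)) x0 g xi k w.
pose S k w := partial_noise f (1 / (2 * L)) x0 g xi k
  (index_enum ('I_M * 'I_H)%type) w.
have [n nE] : exists n : R, n = (M * H)%:R by exists (M * H)%:R.
have n0 : 0 < n by rewrite nE ltr0n muln_gt0 M0.
have light i y : (\int[D i]_z (expR (dotp (g i y z - grad (f i) y)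
     (g i y z - grad (f i) y) / s))%:E <= (expR 1)%:E)%E.
  by have := tail i y; rewrite unlock; under eq_integral do rewrite l2norm_sqr.
pose bad k := [set w | 64 * n * s * lam <= dotp (S k w) (S k w)].
have arg1 : 1 <= (2 * d * T)%:R / delta.
  rewrite ler_pdivlMr// mul1r; apply: (@le_trans _ _ 1); first exact: ltW.
  by rewrite ler1n !muln_gt0 d0 T0.
have arg0 : 0 < (2 * d * T)%:R / delta by lra.
have lam0 : 0 <= lam by exact: ln_ge0.
have KT k : (k < K)%N -> (k.+1 * H <= T)%N by move=> kK; rewrite TE leq_mul2r kK orbT.
have bad_small k : (k < K)%N -> (P (bad k) <= (delta / K%:R)%:E)%E.
  move=> kK; rewrite /bad nE; apply: le_trans
    (round_noise_tail (1 / (2 * L)) x0 df mg iid_xi ind s0 unb light M0 H0 lam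
      (KT k kK)) _.
  (* The factor 2 inside the logarithm absorbs the constant [exp (1 / 16)]. *)
  have e16 : expR (1 / 16) <= 2 :> R.
    have := @expR_ge1Dx R (- (1 / 16)); have := expR_gt0 (1 / 16 : R).
    have : expR (- (1 / 16)) * expR (1 / 16) = 1 :> R by rewrite -expRD addNr expR0.
    set a := expR _; set b := expR _ => ab b0 a1.
    have : 0 <= (a - 15 / 16) * b by apply: mulr_ge0; lra.
    lra.
  rewrite lee_fin expRD expRN lnK ?posrE// invf_div.
  apply: (@le_trans _ _ (2 * (delta / (2 * d * T)%:R))).
    by rewrite ler_wpM2r// divr_ge0// ltW.
  have K0' : 0 < K%:R :> R by rewrite ltr0n.
  have KdT : (K <= d * T)%N.
    rewrite TE; apply: (@leq_trans (1 * (K * 1))); first by rewrite mul1n muln1.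
    by rewrite leq_mul// leq_mul.
  have dT0 : 0 < (d * T)%:R :> R by rewrite ltr0n muln_gt0 d0.
  have -> : 2 * (delta / (2 * d * T)%:R) = delta / (d * T)%:R.
    have -> : (2 * d * T)%:R = 2 * (d * T)%:R :> R by rewrite -natrM mulnA.
    by move: (d * T)%:R dT0 => q q0; field; rewrite lt0r_neq0.
  by rewrite ler_pM2l// lef_pV2 ?posrE// ler_nat.
have mS k : measurable_rV (S k) by exact: measurable_partial_noise.
have mbad k : measurable (bad k).
  rewrite -[X in measurable X]setTI; apply: measurable_fun_ler => //.
  exact: measurable_dotp.
have mx k : measurable_rV (x k).
  exact: (@measurable_iterate R d M H (1 / (2 * L)) x0 _ X g _ Omega P xi mg
    k _ Omega id).
set good := [set w | _].
have mgood : measurable good.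
  rewrite -[X in measurable X]setTI; apply: measurable_fun_ler => //.
    apply: measurable_funB => //.
    apply: (measurableT_comp (f := F : borel_rV R d -> R)
      (g := x K : _ -> borel_rV R d)).
      by apply: continuous_borel_measurable; exact: continuous_global_objective.
    exact: (borel_measurable_coord (mx K)).
  rewrite /r /=; exact: measurable_cst.
have sub : ~` (\big[setU/set0]_(k < K) bad k) `<=` good.
  move=> w hw; have nb k : (k < K)%N -> dotp (S k w) (S k w) <= 64 * n * s * lam.
    move=> kK; rewrite leNgt; apply/negP => /ltW h; apply: hw.
    by rewrite -bigcup_mkord; exists k.
  pose e k : 'rV[R]_d := n^-1 *: S k w.
  have eB k : (k < K)%N -> dotp (e k) (e k) <= 64 * s * lam / n.
    move=> kK; rewrite /e !dotpE.
    have -> : 64 * s * lam / n = n^-1 * (n^-1 * (64 * n * s * lam)).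
      by field; rewrite lt0r_neq0.
    by rewrite !ler_pM2l ?invr_gt0// nb.
  have xE k : x k.+1 w = x k w - (1 / (2 * L)) *: (grad F (x k w) + e k).
    by rewrite /e nE; exact: batched_FL_step.
  have B0 : 0 <= 64 * s * lam / n.
    by apply: divr_ge0; last exact: ltW; rewrite mulr_ge0// mulr_ge0// ltW.
  have := perturbed_gradient_descent xstar mu0 muL B0 scF smF xE eB.
  have N1 : 1 <= (M * T)%:R :> R by rewrite ler1n muln_gt0 M0.
  have rate := geometric_rate mu0 muL N1 KE.
  have r0 : 0 <= F (x 0%N w) - F xstar by rewrite subr_ge0.
  have := ler_wpM2r r0 rate.
  rewrite /good /= -/(x K w) -/(x 0%N w) /r -/(x K w) => h1 h2.
  apply: (le_trans h2); apply: lerD; first by rewrite [leRHS]mulrC.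
  have K0' : K%:R != 0 :> R by rewrite pnatr_eq0 -lt0n.
  have NE : (M * T)%:R = K%:R * n :> R.
    by rewrite nE -natrM TE mulnCA.
  have lnE : ln (M * T)%:R = K%:R / (4 * kappa).
    by rewrite KE /kappa; field; rewrite !lt0r_neq0.
  rewrite lnE NE.
  have -> : 16 * 3 ^+ 2 * kappa * s / (mu * (K%:R * n)) * (K%:R / (4 * kappa)) * lam
    = 36 * (s * lam / (n * mu)).
    by rewrite /kappa; field; rewrite K0' !lt0r_neq0.
  have -> : 64 * s * lam / n / (2 * mu) = 32 * (s * lam / (n * mu)).
    by field; rewrite !lt0r_neq0.
  apply: ler_wpM2r; last by rewrite ler_nat.
  by apply: divr_ge0; rewrite mulr_ge0// ltW.
have mU : measurable (\big[setU/set0]_(k < K) bad k).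
  by apply: bigsetU_measurable.
apply: (@le_trans _ _ (P (~` (\big[setU/set0]_(k < K) bad k)))); last first.
  by apply: le_measure; rewrite ?inE//; exact: measurableC.
rewrite probability_setC// EFinB leeB//.
apply: le_trans (Boole_inequality P (fun k _ => mbad k)) _.
apply: (@le_trans _ _ (\sum_(k < K) (delta / K%:R)%:E)%E).
  by apply: lee_sum => k _; exact: bad_small.
rewrite sumEFin lee_fin sumr_const card_ord -[leLHS]mulr_natr divfK//.
by rewrite pnatr_eq0 -lt0n.
Qed.
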